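(* Let $v=x_1\ldots x_{n-1}$ be a non-empty word over $\{0,1\}$. Then the group $\mathfrak{K}(v)$ is (regular) weakly branch on its derived subgroup $\mathfrak{K}(v)'$.
   Context: Automorphisms of the binary rooted tree $\{0,1\}^*$ act on the right. $\langle\langle g_0,g_1\rangle\rangle$ denotes the automorphism $0u\mapsto0u^{g_0}$, $1u\mapsto1u^{g_1}$; $\sigma$ exchanges $0$ and $1$ in the first letter; $\langle\langle g_0,g_1\rangle\rangle\sigma$ means first apply $\langle\langle g_0,g_1\rangle\rangle$, then $\sigma$. For $v=x_1\ldots x_{n-1}$, $\mathfrak{K}(v)$ is the subgroup of $\mathrm{Aut}(\{0,1\}^* )$ generated by $a_1,\dots,a_n$ defined recursively by $a_1=\langle\langle1,a_n\rangle\rangle\sigma$ and, for $1\le i<n$, $a_{i+1}=\langle\langle a_i,1\rangle\rangle$ if $x_i=0$, $a_{i+1}=\langle\langle1,a_i\rangle\rangle$ if $x_i=1$. A group $G\le\mathrm{Aut}(\{0,1\}^* )$ is regular weakly branch on a subgroup $H\le G$ if $H$ is non-trivial and contains the geometric direct product $H\times H=\{\langle\langle h_0,h_1\rangle\rangle:h_0,h_1\in H\}$. *)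

(* Defs.v *)
From HB Require Import structures.
From mathcomp Require Import all_boot.
From mathcomp Require Import boolp classical_sets.

Set Implicit Arguments.
Unset Strict Implicit.
Unset Printing Implicit Defensive.

Local Open Scope group_scope.
Local Open Scope classical_set_scope.

(* Letters 0 and 1 are [false] and [true]; the vertices of the binary rooted
   tree are the words [u : seq bool], with root [[::]]. *)

(* [is_child u w]: there is an edge from [u] down to [w], i.e. w = ux for some
   letter x. *)
Definition is_child (u w : seq bool) : bool := [exists x, w == rcons u x].

Lemma is_child_nil u : is_child u [::] = false.
Proof. by apply/existsP => -[x /eqP]; case: u. Qed.

Lemma is_child_nilcons x w : is_child [::] (x :: w) = (w == [::]).
Proof.
apply/existsP/eqP => [[y /eqP [_ ->]] //|->].
by exists x.
Qed.

Lemma is_child_cons x u y w :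
  is_child (x :: u) (y :: w) = (x == y) && is_child u w.
Proof.
apply/existsP/andP => [[z /eqP [-> ->]]|[/eqP-> /existsP[z /eqP->]]].
  by split=> //; apply/existsP; exists z.
by exists z.
Qed.

(* Automorphisms of the binary rooted tree, carried with their inverse. *)
Record treeAut := TreeAut {
  aut_fun :> seq bool -> seq bool;
  aut_inv : seq bool -> seq bool;
  aut_funK : cancel aut_fun aut_inv;
  aut_invK : cancel aut_inv aut_fun;
  aut_root : aut_fun [::] = [::];
  aut_child : {mono aut_fun : u w / is_child u w}
}.

Lemma treeAutP (f g : treeAut) : f =1 g -> f = g.
Proof.
case: f g => [f f' fK f'K f0 fc] [g g' gK g'K g0 gc] /= /funext efg.
move: fK f'K f0 fc; rewrite efg => fK f'K f0 fc.
have {}efg : f' = g' by apply/funext => u; rewrite -{1}(g'K u) fK.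
move: fK f'K; rewrite efg => fK f'K.
by congr TreeAut; apply: Prop_irrelevance.
Qed.

HB.instance Definition _ := gen_eqMixin treeAut.
HB.instance Definition _ := gen_choiceMixin treeAut.

Definition aut1 : treeAut :=
  @TreeAut id id (fun=> erefl) (fun=> erefl) erefl (fun _ _ => erefl).

Lemma autM_root (f g : treeAut) : (g \o f) [::] = [::].
Proof. by rewrite /= !aut_root. Qed.

Lemma autM_child (f g : treeAut) : {mono g \o f : u w / is_child u w}.
Proof. by move=> u w; rewrite /= !aut_child. Qed.

(* Automorphisms act on the right: [f * g] applies [f] first, then [g]. *)
Definition autM (f g : treeAut) : treeAut :=
  TreeAut (can_comp (@aut_funK g) (@aut_funK f))
          (can_comp (@aut_invK f) (@aut_invK g))
          (autM_root f g) (@autM_child f g).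

Lemma aut_inv_root (f : treeAut) : aut_inv f [::] = [::].
Proof. by rewrite -{1}(aut_root f) aut_funK. Qed.

Lemma aut_inv_child (f : treeAut) : {mono aut_inv f : u w / is_child u w}.
Proof. by move=> u w; rewrite -(aut_child f) !aut_invK. Qed.

Definition autV (f : treeAut) : treeAut :=
  TreeAut (@aut_invK f) (@aut_funK f) (aut_inv_root f) (@aut_inv_child f).

Lemma autMA : associative autM.
Proof. by move=> f g h; apply: treeAutP. Qed.
Lemma aut1M : left_id aut1 autM.
Proof. by move=> f; apply: treeAutP. Qed.
Lemma autM1 : right_id aut1 autM.
Proof. by move=> f; apply: treeAutP. Qed.
Lemma autVM : left_inverse aut1 autV autM.
Proof. by move=> f; apply: treeAutP => u /=; rewrite aut_invK. Qed.
Lemma autMV : right_inverse aut1 autV autM.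
Proof. by move=> f; apply: treeAutP => u /=; rewrite aut_funK. Qed.

HB.instance Definition _ :=
  isGroup.Build treeAut autMA aut1M autM1 autVM autMV.

(* <<g0, g1>> : 0u |-> 0u^g0, 1u |-> 1u^g1 *)
Definition pair_fun (f0 f1 : seq bool -> seq bool) (u : seq bool) : seq bool :=
  if u is x :: u' then x :: (if x then f1 else f0) u' else [::].

Lemma pair_funK f0 f1 g0 g1 :
  cancel f0 g0 -> cancel f1 g1 -> cancel (pair_fun f0 f1) (pair_fun g0 g1).
Proof. by move=> fK0 fK1 [|[] u] //=; rewrite ?fK0 ?fK1. Qed.

Lemma pair_fun_child (g0 g1 : treeAut) :
  {mono pair_fun g0 g1 : u w / is_child u w}.
Proof.
have nilE (g : treeAut) u : (g u == [::]) = (u == [::]).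
  by rewrite -[X in _ == X](aut_root g) (can_eq (@aut_funK g)).
case=> [|x u] [|y w]; rewrite ?is_child_nil //=.
  by rewrite !is_child_nilcons; case: y; rewrite nilE.
by rewrite !is_child_cons; case: x y => [] [] //=; rewrite aut_child.
Qed.

Definition aut_pair (g0 g1 : treeAut) : treeAut :=
  TreeAut (pair_funK (@aut_funK g0) (@aut_funK g1))
          (pair_funK (@aut_invK g0) (@aut_invK g1))
          erefl (@pair_fun_child g0 g1).

Definition swap_fun (u : seq bool) : seq bool :=
  if u is x :: u' then ~~ x :: u' else [::].

Lemma swap_funK : involutive swap_fun.
Proof. by case=> [|x u] //=; rewrite negbK. Qed.

Lemma swap_fun_child : {mono swap_fun : u w / is_child u w}.
Proof.
case=> [|x u] [|y w]; rewrite ?is_child_nil //= ?is_child_nilcons //.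
by rewrite !is_child_cons; case: x y => [] [].
Qed.

(* The automorphism sigma. *)
Definition aut_swap : treeAut :=
  TreeAut swap_funK swap_funK erefl swap_fun_child.

(* The generators are indexed from 0: with v = x_1 ... x_(n-1), the
   automorphism a_(i+1) is [kgen v i] for 0 <= i < n = (size v).+1, and x_(i+1)
   is [nth false v i]. The recursion is well founded on the words acted upon;
   the lemmas [kgen0] and [kgenS] give it in terms of automorphisms. *)
Fixpoint kgen_fun (v : seq bool) (i : nat) (u : seq bool) : seq bool :=
  if u is x :: u' then
    if i is j.+1 then
      x :: (if x == nth false v j then kgen_fun v j u' else u')
    else ~~ x :: (if x then kgen_fun v (size v) u' else u')
  else [::].

Fixpoint kgen_inv (v : seq bool) (i : nat) (u : seq bool) : seq bool :=
  if u is x :: u' then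
    if i is j.+1 then
      x :: (if x == nth false v j then kgen_inv v j u' else u')
    else ~~ x :: (if x then u' else kgen_inv v (size v) u')
  else [::].

Lemma kgen_funK v i : cancel (kgen_fun v i) (kgen_inv v i).
Proof.
move=> u; elim: u i => [|x u IH] [|i] //=; last by case: eqP; rewrite ?IH.
by case: x => //=; rewrite IH.
Qed.

Lemma kgen_invK v i : cancel (kgen_inv v i) (kgen_fun v i).
Proof.
move=> u; elim: u i => [|x u IH] [|i] //=; last by case: eqP; rewrite ?IH.
by case: x => //=; rewrite IH.
Qed.

Lemma kgen_fun_root v i : kgen_fun v i [::] = [::].
Proof. by []. Qed.

Lemma kgen_fun_child v i : {mono kgen_fun v i : u w / is_child u w}.
Proof.
have nilE j u : (kgen_fun v j u == [::]) = (u == [::]).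
  by case: u j => [|x u] [|j].
move=> u w; elim: u w i => [|x u IH] [|y w] i; rewrite ?is_child_nil //.
  by case: i => [|i] /=; rewrite !is_child_nilcons //; case: ifP; rewrite ?nilE.
case: i => [|i] /=; rewrite !is_child_cons.
  by case: x y => [] [] //=; rewrite IH.
by case: eqP => //= ->; case: eqP => //= _; rewrite IH.
Qed.

Definition kgen (v : seq bool) (i : nat) : treeAut :=
  TreeAut (@kgen_funK v i) (@kgen_invK v i) (kgen_fun_root v i)
          (@kgen_fun_child v i).

Lemma kgen0 v : kgen v 0 = aut_pair 1 (kgen v (size v)) * aut_swap.
Proof. by apply: treeAutP => -[|[] u]. Qed.

Lemma kgenS v i :
  kgen v i.+1 = if nth false v i then aut_pair 1 (kgen v i)
                else aut_pair (kgen v i) 1.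
Proof.
by case E: (nth false v i); apply: treeAutP => -[|[] u] //=; rewrite E.
Qed.

Definition is_subgroup (H : set treeAut) : Prop :=
  [/\ H 1, forall g h, H g -> H h -> H (g * h) & forall g, H g -> H g^-1].

Definition generated (S : set treeAut) : set treeAut := smallest is_subgroup S.

Definition derived (G : set treeAut) : set treeAut :=
  generated [set [~ g, h] | g in G & h in G].

Definition kneading_group (v : seq bool) : set treeAut :=
  generated [set kgen v i | i in [set i | i < (size v).+1]].

Definition geom_prod (H0 H1 : set treeAut) : set treeAut :=
  [set aut_pair h0 h1 | h0 in H0 & h1 in H1].

Definition regular_weakly_branch (G H : set treeAut) : Prop :=
  [/\ is_subgroup G, is_subgroup H, H `<=` G, H <> [set 1]
    & geom_prod H H `<=` H].

(* Main.v *)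
Require Import Defs.
From mathcomp Require Import all_boot.
From mathcomp Require Import classical_sets.

(** The point is to exhibit <<[g, h], 1>> inside the derived subgroup G' of
    G = K(v), for all g and h in G.

    For a pair of generators this is a direct computation. With n generators
    a_1, ..., a_n, every a_i with i < n occurs alone in the first coordinate of
    an element <<a_i, 1>> of G, which is a_(i+1) itself or its conjugate by the
    inverse of a_1, while a_1 ^+ 2 = <<a_n, a_n>>. In the commutator of two such
    elements, the second coordinate is a commutator with 1 (or of a_n with
    itself), so it vanishes, which leaves <<[a_i, a_j], 1>> in G'
    ([kgen_commutator]).

    The identity [g k, h] = [g, h]^k [k, h] extends this to all g and h: every
    k in G is the first coordinate of some <<k, k'>> in G, and conjugation by
    <<k, k'>> preserves the normal subgroup G' of G while it turns <<x, 1>>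
    into <<x^k, 1>> ([derived_pair1]). Conjugation by a_1 then exchanges the
    coordinates, as <<x, 1>> ^ a_1 = <<1, x>>, so G' contains G' x G'.

    Finally G' is nontrivial because a_1 and a_2 do not commute; v being
    non-empty is what makes a_2 a generator. *)

Set Implicit Arguments.
Unset Strict Implicit.
Unset Printing Implicit Defensive.

Local Open Scope group_scope.
Local Open Scope classical_set_scope.

Lemma commMgJ (gT : groupType) (x y z : gT) :
  [~ x * y, z] = [~ x, z] ^ y * [~ y, z].
Proof. by rewrite !commgEl !conjgE !invgM !mulgA !mulgK. Qed.

Lemma aut_pairM g0 g1 h0 h1 :
  aut_pair g0 g1 * aut_pair h0 h1 = aut_pair (g0 * h0) (g1 * h1).
Proof. by apply: treeAutP => -[|[] u]. Qed.

Lemma aut_pairV g0 g1 : (aut_pair g0 g1)^-1 = aut_pair g0^-1 g1^-1.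
Proof. by apply: treeAutP => -[|[] u]. Qed.

Lemma aut_pair1 : aut_pair 1 1 = 1.
Proof. by apply: treeAutP => -[|[] u]. Qed.

Lemma aut_pairJ g0 g1 h0 h1 :
  aut_pair g0 g1 ^ aut_pair h0 h1 = aut_pair (g0 ^ h0) (g1 ^ h1).
Proof. by rewrite !conjgE aut_pairV !aut_pairM. Qed.

Lemma aut_pairR g0 g1 h0 h1 :
  [~ aut_pair g0 g1, aut_pair h0 h1] = aut_pair [~ g0, h0] [~ g1, h1].
Proof. by rewrite !commgEl aut_pairJ aut_pairV aut_pairM. Qed.

Lemma aut_swapV : aut_swap^-1 = aut_swap.
Proof. exact: treeAutP. Qed.

Lemma aut_pairJswap g0 g1 : aut_pair g0 g1 ^ aut_swap = aut_pair g1 g0.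
Proof. by rewrite conjgE aut_swapV; apply: treeAutP => -[|[] u]. Qed.

Lemma kgen0J v g0 g1 :
  aut_pair g0 g1 ^ kgen v 0 = aut_pair (g1 ^ kgen v (size v)) g0.
Proof. by rewrite kgen0 conjgM aut_pairJ conjg1 aut_pairJswap. Qed.

Lemma kgen0_sqr v :
  kgen v 0 * kgen v 0 = aut_pair (kgen v (size v)) (kgen v (size v)).
Proof. by apply: treeAutP => -[|[] u]. Qed.

Lemma generated_subgroup S : is_subgroup (generated S).
Proof.
split=> [|g h Sg Sh|g Sg] A [sA SA].
- by case: sA.
- by case: (sA) => _ AM _; apply: AM; [exact: Sg|exact: Sh].
- by case: (sA) => _ _ AV; apply: AV; exact: Sg.
Qed.

Lemma mem_generated (S : set treeAut) g : S g -> generated S g.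
Proof. exact: sub_gen_smallest. Qed.

Lemma subgroupJ H g h : is_subgroup H -> H g -> H h -> H (g ^ h).
Proof. by case=> _ HM HV Hg Hh; apply: HM (HV _ Hh) (HM _ _ Hg Hh). Qed.

Lemma subgroup1 H : is_subgroup H -> H 1.
Proof. by case. Qed.

Lemma subgroupM H g h : is_subgroup H -> H g -> H h -> H (g * h).
Proof. by case=> _ HM _; apply: HM. Qed.

Lemma subgroupV H g : is_subgroup H -> H g -> H g^-1.
Proof. by case=> _ _; apply. Qed.

Lemma derived_subgroup G : is_subgroup (derived G).
Proof. exact: generated_subgroup. Qed.

Lemma mem_derived (G : set treeAut) g h : G g -> G h -> derived G [~ g, h].
Proof. by move=> Gg Gh; apply: mem_generated; exists g => //; exists h. Qed.

Lemma derived_sub G : is_subgroup G -> derived G `<=` G.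
Proof.
move=> sG; apply: smallest_sub => // _ [g Gg [h Gh <-]].
rewrite commgEl.
exact: (subgroupM sG (subgroupV sG Gg) (subgroupJ sG Gg Gh)).
Qed.

Lemma derivedJ G x g : is_subgroup G -> derived G x -> G g -> derived G (x ^ g).
Proof.
move=> sG + Gg; apply: (@smallest_sub _ _ _ [set x | derived G (x ^ g)]).
  have sG' := derived_subgroup G.
  split=> [|y z /= Gy Gz|y /= Gy]; first by rewrite /= conj1g; exact: subgroup1.
    by rewrite conjMg; exact: (subgroupM sG').
  by rewrite conjVg; exact: (subgroupV sG').
move=> _ [y Gy [z Gz <-]] /=.
by rewrite conjRg; apply: mem_derived; apply: (subgroupJ sG).
Qed.

(** Let K' be the derived subgroup of K. The x in G with <<x, 1>> in K' form a
    subgroup, which is normal in G: every g in G has a lift <<g, g'>> in K, and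
    <<x, 1>> ^ <<g, g'>> = <<x ^ g, 1>>. A normal subgroup of G that contains
    the commutators of the generators contains the derived subgroup of G. *)
Lemma derived_pair1 (S : set treeAut) (G := generated S) K :
  is_subgroup K ->
  (forall s, S s -> exists s', K (aut_pair s s')) ->
  (forall s t, S s -> S t -> derived K (aut_pair [~ s, t] 1)) ->
  forall x, derived G x -> derived K (aut_pair x 1).
Proof.
move=> sK liftS commS; have sK' := derived_subgroup K.
have liftG g : G g -> exists g', K (aut_pair g g').
  move: g.
  apply: (@smallest_sub _ _ _ [set g | exists g', K (aut_pair g g')]) => //.
  split=> [|g h [g1 Kg] [h1 Kh]|g [g1 Kg]].
  - by exists 1; rewrite aut_pair1; apply: (subgroup1 sK).
  - by exists (g1 * h1); rewrite -aut_pairM; apply: (subgroupM sK).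
  - by exists g1^-1; rewrite -aut_pairV; apply: (subgroupV sK).
have pair1J x g : G g -> derived K (aut_pair x 1) ->
    derived K (aut_pair (x ^ g) 1).
  move=> /liftG [g' Kg] Kx.
  by rewrite -(conj1g g') -aut_pairJ; apply: derivedJ.
have pair1M x y : derived K (aut_pair x 1) -> derived K (aut_pair y 1) ->
    derived K (aut_pair (x * y) 1).
  by move=> Kx Ky; rewrite -(mulg1 1) -aut_pairM; apply: (subgroupM sK').
have pair1V x : derived K (aut_pair x 1) -> derived K (aut_pair x^-1 1).
  by move=> Kx; rewrite -invg1 -aut_pairV; apply: (subgroupV sK').
have sG : is_subgroup G by apply: generated_subgroup.
(* For fixed h, the g with <<[g, h], 1>> in K' are closed under products by
   [g k, h] = [g, h]^k [k, h]. This is used once for each argument of the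
   commutator, passing from one to the other by [g, h]^-1 = [h, g]. *)
have comm_extend h : (forall s, S s -> derived K (aut_pair [~ s, h] 1)) ->
    forall g, G g -> derived K (aut_pair [~ g, h] 1).
  move=> Sh g Gg.
  suff: (G `&` [set g | derived K (aut_pair [~ g, h] 1)]) g by case.
  move: g Gg; apply: smallest_sub; last first.
    by move=> s Ss; split; [apply: mem_generated|apply: Sh].
  split=> [|g k [Gg Kg] [Gk Kk]|g [Gg Kg]].
  - split; first exact: (subgroup1 sG).
    by rewrite /= comm1g aut_pair1; apply: (subgroup1 sK').
  - split; first exact: (subgroupM sG).
    by rewrite /= commMgJ; apply: pair1M => //; apply: pair1J.
  - have Gg' : G g^-1 by apply: (subgroupV sG).
    split=> //=.
    have -> : [~ g^-1, h] = [~ g, h]^-1 ^ g^-1.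
      apply: (mulgI ([~ g, h] ^ g^-1)).
      by rewrite -commMgJ conjVg !mulgV comm1g.
    by apply: pair1J => //; apply: pair1V.
apply: smallest_sub.
  split=> [|x y /=|x /=]; last exact: pair1V; last exact: pair1M.
  by rewrite /= aut_pair1; apply: (subgroup1 sK').
move=> _ [g Gg [h Gh <-]] /=; apply: (comm_extend) Gg => s Ss.
rewrite -invgR; apply: pair1V; apply: (comm_extend) Gh => t St.
exact: commS.
Qed.

Lemma mem_kgen v i : i <= size v -> kneading_group v (kgen v i).
Proof. by move=> le_iv; apply: mem_generated; exists i. Qed.

(** The square a_1 ^+ 2 = <<a_n, a_n>> lifts the last generator; any other a_i
    is moved down by a_(i+1), to the left or to the right subtree according to
    x_i, and conjugation by the inverse of a_1 brings the right one to the left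
    unchanged. *)
Lemma kgen_lift v i : i <= size v ->
  kneading_group v (aut_pair (kgen v i) (if i == size v then kgen v i else 1)).
Proof.
have sG : is_subgroup (kneading_group v) by apply: generated_subgroup.
have G0 : kneading_group v (kgen v 0) by apply: mem_kgen.
case: eqP => [-> _|/eqP ne_iv].
  by rewrite -kgen0_sqr; apply: (subgroupM sG).
rewrite leq_eqVlt (negPf ne_iv) => /= /(@mem_kgen v i.+1).
rewrite kgenS; case: ifP => // _ GSi.
(* In this case <<kgen v i, 1>> ^ a_1 = <<1, kgen v i>> = kgen v i.+1. *)
rewrite -(conjgK (kgen v 0) (aut_pair _ 1)) kgen0J conj1g.
by apply: (subgroupJ sG) => //; apply: (subgroupV sG).
Qed.

Lemma kgen_commutator v i j : i <= size v -> j <= size v ->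
  derived (kneading_group v) (aut_pair [~ kgen v i, kgen v j] 1).
Proof.
move=> le_iv le_jv; have := mem_derived (kgen_lift le_iv) (kgen_lift le_jv).
rewrite aut_pairR; case: eqP => [->|_]; last by rewrite comm1g.
by case: eqP => [->|_]; rewrite ?commgg ?commg1.
Qed.

Lemma derived_kneading_pair1 v x : derived (kneading_group v) x ->
  derived (kneading_group v) (aut_pair x 1).
Proof.
apply: derived_pair1; first exact: generated_subgroup.
  by move=> _ [i /= le_iv <-]; eexists; apply: kgen_lift.
by move=> _ _ [i /= le_iv <-] [j /= le_jv <-]; apply: kgen_commutator.
Qed.

(** On a word starting with 0, a_1 changes the first letter only, while a_2 fixes
    the first letter and changes the second one exactly when the first is x_1
    (0 by default). So exactly one of a_1 a_2 and a_2 a_1 changes the second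
    letter of 00. *)
Lemma kgen01_noncommute v : kgen v 0 * kgen v 1 <> kgen v 1 * kgen v 0.
Proof.
move=> /(congr1 (fun f : treeAut => f [:: false; false])) /=.
by case: (nth _ _ _).
Qed.

Theorem theorem3p12 (v : seq bool) (v_nonempty : v != [::]) :
  regular_weakly_branch (kneading_group v) (derived (kneading_group v)).
Proof.
have sG : is_subgroup (kneading_group v) by apply: generated_subgroup.
have sG' := derived_subgroup (kneading_group v).
have G0 : kneading_group v (kgen v 0) by apply: mem_kgen.
split=> //; first exact: derived_sub.
  move=> G'1; apply: (@kgen01_noncommute v); apply/commgP/eqP.
  have G1 : kneading_group v (kgen v 1).
    by apply: mem_kgen; rewrite lt0n size_eq0.
  by have := mem_derived G0 G1; rewrite G'1.
move=> _ [g Gg [h Gh <-]].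
rewrite -(mulg1 g) -(mul1g h) -aut_pairM.
apply: (subgroupM sG'); first exact: derived_kneading_pair1.
(* <<1, h>> = <<h, 1>> ^ a_1 *)
rewrite -(conj1g (kgen v (size v))) -kgen0J.
by apply: derivedJ => //; apply: derived_kneading_pair1.
Qed.
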